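(* Let $F_n, F\colon[0,+\infty)\to[0,+\infty)$, $n=1,2,\dots$, be continuous metric preserving functions with $F_n\to F$ pointwise. Then the following are equivalent: (1) For any sequence $\{X_n\}_{n\in\mathbb N}$ of mm-spaces concentrating to an mm-space $X$, the sequence $\{(X_n, F_n\circ d_{X_n}, m_{X_n})\}_{n\in\mathbb N}$ concentrates to $(X, F\circ d_X, m_X)$. (2) For every $s\in[0,+\infty)$, $\lim_{n\to\infty}\big(F_n(s)-\inf_{s\le s'}F_n(s')\big)=0$.
   Context: An mm-space is a triple $(X,d_X,m_X)$ with $(X,d_X)$ complete separable metric space and $m_X$ a Borel probability measure, considered up to mm-isomorphism. A function $F\colon[0,+\infty)\to[0,+\infty)$ is metric preserving if $F\circ d_X$ is a metric for every metric space $(X,d_X)$; for continuous such $F$, $(X,F\circ d_X)$ is again complete separable with the same topology. Concentration: Let $I=[0,1)$ with Lebesgue measure $\mathcal L^1$. A parameter of $X$ is a Borel map $\varphi\colon I\to X$ with $\varphi_*\mathcal L^1=m_X$. The Ky Fan metric on measurable functions $I\to\mathbb R$ is $\mathrm{me}(f,g)=\inf\{\varepsilon\ge0:\mathcal L^1(|f-g|>\varepsilon)\le\varepsilon\}$. The observable distance is $d_{\mathrm{conc}}(X,Y)=\inf_{\varphi,\psi}d_H(\{f\circ\varphi: f\in\mathrm{Lip}_1(X)\},\{g\circ\psi: g\in\mathrm{Lip}_1(Y)\})$, infimum over parameters, $d_H$ Hausdorff distance w.r.t. the Ky Fan metric, $\mathrm{Lip}_1$ the real 1-Lipschitz functions.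 $\{X_n\}$ concentrates to $X$ if $d_{\mathrm{conc}}(X_n,X)\to0$. *)

(* Defs.v *)
From HB Require Import structures.
From mathcomp Require Import all_boot all_order all_algebra.
From mathcomp Require Import all_classical all_reals all_analysis.
Set Implicit Arguments. Unset Strict Implicit. Unset Printing Implicit Defensive.
Import Order.TTheory GRing.Theory Num.Theory.
Import numFieldNormedType.Exports.
Local Open Scope classical_set_scope.
Local Open Scope ring_scope.

Definition is_metric (R : realType) (T : Type) (d : T -> T -> R) : Prop :=
  (forall x y, d x y = 0 <-> x = y) /\
  (forall x y, d x y = d y x) /\
  (forall x y z, d x z <= d x y + d y z).

Definition metric_preserving (R : realType) (F : R -> R) : Prop :=
  (forall t, 0 <= t -> 0 <= F t) /\
  forall (T : Type) (d : T -> T -> R), is_metric d -> is_metric (fun x y => F (d x y)).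

Definition cont_metric_preserving (R : realType) (F : R -> R) : Prop :=
  metric_preserving F /\ {within `[0, +oo[, continuous F}.

Definition dopen (R : realType) (T : Type) (d : T -> T -> R) : set (set T) :=
  [set A | forall x, A x -> exists2 e : R, 0 < e & forall y, d x y < e -> A y].

Definition dcomplete (R : realType) (T : Type) (d : T -> T -> R) : Prop :=
  forall u : nat -> T,
    (forall e : R, 0 < e -> exists N, forall m n, (N <= m)%N -> (N <= n)%N -> d (u m) (u n) < e) ->
    exists x, d (u n) x @[n --> \oo] --> 0.

Definition dseparable (R : realType) (T : Type) (d : T -> T -> R) : Prop :=
  exists S : set T, countable S /\
    forall x (e : R), 0 < e -> exists2 y, S y & d x y < e.

Record mmspace (R : realType) := MMSpace {
  mm_disp : measure_display;
  mm_T : measurableType mm_disp;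
  mm_dist : mm_T -> mm_T -> R;
  mm_meas : probability mm_T R }.
Arguments mm_dist {R} m _ _.
Arguments mm_meas {R} m.
Arguments mm_T {R} m.

(* (X, d, m) is an mm-space: d is a complete separable metric and the
   measurable sets of the carrier are exactly the Borel sets of d, so that
   m is a Borel probability measure. *)
Definition is_mm (R : realType) (X : mmspace R) : Prop :=
  is_metric (mm_dist X) /\ dcomplete (mm_dist X) /\ dseparable (mm_dist X) /\
  (@measurable _ (mm_T X)) = <<s dopen (mm_dist X) >>.

Definition mm_comp (R : realType) (F : R -> R) (X : mmspace R) : mmspace R :=
  @MMSpace R (mm_disp X) (mm_T X) (fun x y => F (mm_dist X x y)) (mm_meas X).

Definition unitI (R : realType) : set R := `[0, 1[.

Definition is_parameter (R : realType) (X : mmspace R) (phi : R -> mm_T X) : Prop :=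
  measurable_fun (@unitI R) phi /\
  forall A : set (mm_T X), measurable A ->
    (@lebesgue_measure R) (@unitI R `&` phi @^-1` A) = mm_meas X A.

Definition lip1 (R : realType) (X : mmspace R) : set (mm_T X -> R) :=
  [set f | forall x y, `|f x - f y| <= mm_dist X x y].

Arguments lip1 {R} X.
Arguments is_parameter {R} X phi.

Definition kyfan (R : realType) (f g : R -> R) : R :=
  inf [set e : R | 0 <= e /\
    ((@lebesgue_measure R) (@unitI R `&` [set x | (e < `|f x - g x|)%R]) <= e%:E)%E].

Definition hausdorff_kf (R : realType) (A B : set (R -> R)) : R :=
  Num.max (sup [set inf [set kyfan a b | b in B] | a in A])
          (sup [set inf [set kyfan a b | a in A] | b in B]).

Definition dconc (R : realType) (X Y : mmspace R) : R :=
  inf [set hausdorff_kf [set f \o pp.1 | f in lip1 X] [set g \o pp.2 | g in lip1 Y]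
      | pp in [set pp : (R -> mm_T X) * (R -> mm_T Y) |
               is_parameter X pp.1 /\ is_parameter Y pp.2]].

Definition concentrates (R : realType) (Xs : nat -> mmspace R) (X : mmspace R) : Prop :=
  dconc (Xs n) X @[n --> \oo] --> 0.

(* Main.v *)
(** Parameters of [X] are also parameters of [(X, F o d_X)], so everything happens
    on families of functions on [0, 1) up to the Ky Fan distance.

    (2) => (1): cover most of [X] by finitely many balls [B(x_i, delta)] and let [J_i]
    be the part of [0, 1) sent into [B(x_i, delta)].  If the 1-Lipschitz functions of
    [Y = X_n] and [X] are close, the images of [J_i] and [J_j] in [Y] are, up to small
    measure, at distance at least about [d(x_i, x_j)], and any two large parts of them
    contain points at distance about [d(x_i, x_j)].  A function [g] that is 1-Lipschitz
    for [F o d_X] is transported by the McShane formula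
    [f(y) = inf (g(x_i) + F_n(d(y, phi t)))] over [t] in [J_i]; as [d(y, phi t)] can be
    much larger than [d(x_i, x_j)], this is where condition (2) is used.  Conversely a
    function that is 1-Lipschitz for [F_n o d_Y] is within a small constant of a
    [C]-Lipschitz function, hence almost constant on each [J_i], and the McShane
    extension of these constants is 1-Lipschitz for [F o d_X].

    (1) => (2): take two copies of a Hamming cube of diameter [L_n] glued so that the
    distance between [(x, true)] and [(y, false)] is [s + ham(x, y) L_n / N_n].  By
    concentration of measure on the cube this converges to two points at distance [s]
    when [N_n] grows fast, although antipodal points of the two copies are at distance
    [s + L_n].  If [F_n(s + L_n) < F_n(s) - e], every function that is 1-Lipschitz for
    [F_n o d] is almost constant on each copy, with values less than
    [F_n(s + L_n) + o(1)] apart, and the limit cannot be two points at distance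
    [F(s)]. *)

Require Import Defs.
From HB Require Import structures.
From mathcomp Require Import all_boot all_order all_algebra.
From mathcomp Require Import all_classical all_reals all_analysis.
From mathcomp Require Import ring lra.
Import Order.TTheory GRing.Theory Num.Theory.
Import numFieldNormedType.Exports.
Local Open Scope classical_set_scope.
Local Open Scope ring_scope.
Set Implicit Arguments.
Unset Strict Implicit.

(** * Metric preserving functions and McShane extensions *)

Section MetricPreserving.
Context {R : realType} {F : R -> R}.
Hypothesis mpF : metric_preserving F.

(** A three-point space with prescribed sides: feeding it to [metric_preserving] is how triangle
    inequalities for [F] are extracted. *)
Definition tri_dist (a b c : R) (i j : option bool) : R :=
  match i, j with
  | None, None => 0 | Some true, Some true => 0 | Some false, Some false => 0
  | None, Some true => a | Some true, None => a
  | Some true, Some false => b | Some false, Some true => b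
  | None, Some false => c | Some false, None => c
  end.

Lemma tri_dist_metric (a b c : R) : 0 < a -> 0 < b -> 0 < c ->
  a <= b + c -> b <= a + c -> c <= a + b -> is_metric (tri_dist a b c).
Proof.
move=> a0 b0 c0 abc bac cab; split; [|split].
- by move=> [[]|] [[]|]; split => //= h; exfalso; move: h; lra.
- by move=> [[]|] [[]|].
- by move=> [[]|] [[]|] [[]|] /=; lra.
Qed.

Lemma mp0 : F 0 = 0.
Proof.
have [_ /(_ unit (fun _ _ => 0))] := mpF; case.
  by split; [move=> [] []; split|split => // *; rewrite ?addr0].
by move=> /(_ tt tt)[_ ->].
Qed.

Lemma mp_ge0 t : 0 <= t -> 0 <= F t.
Proof. by case: mpF => h _; exact: h. Qed.

Lemma mp_triangle (a b c : R) : 0 <= a -> 0 <= b -> 0 <= c ->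
  a <= b + c -> b <= a + c -> c <= a + b -> F a <= F b + F c.
Proof.
move=> a0 b0 c0 abc bac cab.
(* [tri_dist] is a metric only for positive sides; a vanishing side makes the other two equal or the
   claim trivial. *)
have [->|an0] := eqVneq a 0; first by rewrite mp0 addr_ge0 ?mp_ge0.
have [e|bn0] := eqVneq b 0.
  by rewrite e mp0 add0r (_ : a = c)//; lra.
have [e|cn0] := eqVneq c 0.
  by rewrite e mp0 addr0 (_ : a = b)//; lra.
have [_ /(_ _ (tri_dist a b c))] := mpF; case.
  by apply: tri_dist_metric; rewrite ?lt0r ?an0 ?bn0 ?cn0.
by move=> _ [_ /(_ None (Some false) (Some true))] /=; rewrite addrC.
Qed.

Lemma mp_dist (a b : R) : 0 <= a -> 0 <= b -> F a <= F b + F `|a - b|.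
Proof.
move=> a0 b0; apply: mp_triangle => //; have [h|h] := leP 0 (a - b);
  rewrite ?(ger0_norm h) ?(ltr0_norm h); lra.
Qed.

(** Isosceles triangle with sides [a], [b], [b]. This replaces monotonicity, which [F] may lack, at
    the cost of a factor 2. *)
Lemma mp_le2 (a b : R) : 0 <= a -> a <= b * 2 -> F a <= F b * 2.
Proof. by move=> a0 ab; rewrite mulr_natr mulr2n; apply: mp_triangle; lra. Qed.

(** A length [t] is cut into pieces of length [d], each costing at most [h * 2]. Smallness of [F] at
    one scale thus gives a Lipschitz bound up to an additive constant. *)
Lemma mp_linear (d h t : R) : 0 < d -> F d <= h -> 0 <= t ->
  F t <= h * 2 + h * 2 / d * t.
Proof.
move=> d0 Fdh t0.
have h0 : 0 <= h by rewrite (le_trans _ Fdh)// mp_ge0// ltW.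
have key k : forall t, 0 <= t -> t <= d * k.+1%:R -> F t <= h * 2 * k.+1%:R.
  elim: k => [|k IH] u u0 uk.
    by rewrite mulr1; apply: (le_trans (@mp_le2 u d _ _)) => //; lra.
  have [ud|du] := leP u d.
    apply: (le_trans (@mp_le2 u d _ _)) => //; first by lra.
    rewrite -[leLHS]mulr1; apply: ler_pM => //; last by rewrite ler1n.
    - by rewrite mulr_ge0// mp_ge0// ltW.
    - lra.
  apply: (le_trans (@mp_triangle u (u - d) d _ _ _ _ _ _)) => //; try lra.
  have -> : h * 2 * k.+2%:R = h * 2 * k.+1%:R + h * 2.
    by rewrite -(natr1 k.+1) mulrDr mulr1.
  apply: lerD; last by lra.
  by apply: IH; rewrite -?(natr1 _ k.+1) in uk *; lra.
set k := Num.truncn (t / d).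
have td0 : 0 <= t / d by rewrite divr_ge0// ltW.
have := truncn_itv td0 => /andP[k1 k2].
apply: (le_trans (key k t t0 _)).
  by rewrite mulrC -ler_pdivrMr// ltW.
have -> : h * 2 + h * 2 / d * t = h * 2 * (1 + t / d).
  by ring.
by rewrite ler_wpM2l ?mulr_ge0// -natr1 addrC lerD2l.
Qed.

End MetricPreserving.

Lemma cont_mp_small (R : realType) (F : R -> R) (e : R) :
  cont_metric_preserving F -> 0 < e -> exists2 d : R, 0 < d & F d < e.
Proof.
move=> [mpF cF] e0.
have : F x @[x --> 0^'+] --> F 0.
  by move: cF => /continuous_within_itvcyP[].
rewrite (mp0 mpF) => /cvgrPdist_lt/(_ _ e0) h.
near (0 : R)^'+ => d; exists d; first by near: d; exact: nbhs_right_gt.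
have : `|0 - F d| < e by near: d.
by rewrite sub0r normrN; exact/le_lt_trans/ler_norm.
Unshelve. all: by end_near. Qed.

Section McShane.
Context {R : realType} {T : Type} {rho : T -> T -> R}.
Hypothesis rhoP : is_metric rho.

Lemma metric_ge0 x y : 0 <= rho x y.
Proof.
case: rhoP => r0 [rC rt]; have := rt x y x.
by rewrite (r0 x x).2// (rC y x); lra.
Qed.

(* [inf set0 = 0], so the empty family gives the constant function 0. *)
Definition infconv (S : set (T * R)) (x : T) : R :=
  inf [set p.2 + rho x p.1 | p in S].

Lemma infconv_le (S : set (T * R)) (m : T -> R) p x :
  (forall y p, S p -> m y <= p.2 + rho y p.1) -> S p ->
  infconv S x <= p.2 + rho x p.1.
Proof.
move=> Sm Sp; apply: ge_inf; last by exists p.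
by exists (m x) => _ [q Sq <-]; exact: Sm.
Qed.

Lemma infconv_ge (S : set (T * R)) (m : R) x : S !=set0 ->
  (forall p, S p -> m <= p.2 + rho x p.1) -> m <= infconv S x.
Proof.
move=> [p Sp] Sm; apply: lb_le_inf; first by eexists; exists p.
by move=> _ [q Sq <-]; exact: Sm.
Qed.

Lemma infconv_lip (S : set (T * R)) (m : T -> R) x y :
  (forall y p, S p -> m y <= p.2 + rho y p.1) ->
  `|infconv S x - infconv S y| <= rho x y.
Proof.
move=> Sm; have [S0|/set0P S0] := eqVneq S set0.
  by rewrite /infconv S0 !image_set0 subrr normr0 metric_ge0.
wlog xy : x y / infconv S y <= infconv S x.
  move=> h; have [xy|xy] := leP (infconv S y) (infconv S x); first exact: h.
  by rewrite distrC; case: (rhoP) => _ [rC _]; rewrite rC; apply: h; exact: ltW.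
rewrite ger0_norm ?subr_ge0// lerBlDr -lerBlDl.
apply: infconv_ge => // p Sp; rewrite lerBlDl.
apply: (le_trans (infconv_le x Sm Sp)).
by case: (rhoP) => _ [_ rt]; have := rt x y p.1; lra.
Qed.

(** Finitely many base values bound the family below, so the infimum is genuine and [infconv_le] and
    [infconv_lip] apply. *)
Lemma infconv_fin_bound (K : nat) (a : nat -> R) (S : set (T * R)) :
  (forall p, S p -> exists2 i, (i < K)%N & p.2 = a i) ->
  exists m : T -> R, forall y p, S p -> m y <= p.2 + rho y p.1.
Proof.
move=> Sa; exists (fun=> \big[Order.min/0]_(i < K) a i) => y p /Sa[i iK ->].
apply: (@le_trans _ _ (a i)); last by rewrite lerDl metric_ge0.
exact: (bigmin_le 0 (Ordinal iK) (fun i : 'I_K => a i)).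
Qed.

End McShane.

(** The inf-convolution of [f] with the metric [C * d] drops by at most the slack [h]. It turns
    functions Lipschitz for [G o d] into nearby functions that are Lipschitz for [d]. *)
Lemma lip_regularization (R : realType) (T : Type) (d : T -> T -> R)
    (f : T -> R) (h C : R) : is_metric d -> 0 < C ->
  (forall x y, `|f x - f y| <= h + C * d x y) ->
  exists ft : T -> R, (forall x y, `|ft x - ft y| <= C * d x y) /\
    (forall x, f x - h <= ft x <= f x).
Proof.
move=> md C0 fh; pose rho x y := C * d x y.
have mrho : is_metric rho.
  case: (md) => d0 [dC dt]; split; [|split].
  - move=> y z; split => [/eqP|/(d0 _ _).2 yz]; last by rewrite /rho yz mulr0.
    by rewrite mulf_eq0 gt_eqF//= => /eqP/(d0 _ _).1.
  - by move=> y z; rewrite /rho dC.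
  - by move=> y z w; rewrite /rho -mulrDr ler_pM2l.
pose S : set (T * R) := range (fun z => (z, f z)).
have Sm y p : S p -> f y - h <= p.2 + rho y p.1.
  by move=> [z _ <-] /=; have := fh y z; rewrite ler_norml /rho; lra.
exists (infconv (rho := rho) S); split => [x y|x].
  exact: (infconv_lip mrho x y Sm).
apply/andP; split.
  by apply: infconv_ge; [exists (x, f x); exists x|exact: Sm].
have := @infconv_le _ _ rho S (fun y => f y - h) (x, f x) x Sm.
by rewrite /= (mrho.1 _ _).2// addr0; apply; exists x.
Qed.

(** * Ky Fan and observable distances *)

Section OuterMeasure.
Context {R : realType}.
Implicit Types (A B : set R) (u v : R -> R).

(* The library's Lebesgue measure is the Caratheodory outer measure, hence it is
   monotone and subadditive on arbitrary sets. *)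
Definition leb_outer : {outer_measure set (ocitv_type R) -> \bar R} :=
  mu_ext (wlength (@idfun R)).

Lemma leb_outerE A : @lebesgue_measure R A = leb_outer A.
Proof. by []. Qed.

Definition lam A : R := fine (@lebesgue_measure R (@unitI R `&` A)).

Lemma lebesgue_le A B : A `<=` B ->
  (@lebesgue_measure R A <= @lebesgue_measure R B)%E.
Proof. exact: (le_outer_measure leb_outer). Qed.

Lemma lebesgue_unitI : @lebesgue_measure R (@unitI R) = 1%E.
Proof. by rewrite lebesgue_measure_itv /= lte01 sube0. Qed.

Lemma lamE A : @lebesgue_measure R (@unitI R `&` A) = (lam A)%:E.
Proof.
rewrite fineK// ge0_fin_numE; last exact: (outer_measure_ge0 leb_outer).
by rewrite (le_lt_trans (lebesgue_le (@subIsetl _ _ _)))// lebesgue_unitI ltry.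
Qed.

Lemma lam_le A B : (forall t, unitI t -> A t -> B t) -> lam A <= lam B.
Proof.
move=> AB; rewrite -lee_fin -!lamE; apply: lebesgue_le => t [It At].
by split => //; exact: AB.
Qed.

Lemma lam_le1 A : lam A <= 1.
Proof. by rewrite -lee_fin -lamE -lebesgue_unitI; exact: lebesgue_le. Qed.

Lemma lamU A B : lam (A `|` B) <= lam A + lam B.
Proof.
by rewrite -lee_fin EFinD -!lamE setIUr; exact: (outer_measureU2 leb_outer).
Qed.

Lemma lam0 : lam set0 = 0.
Proof. by rewrite /lam setI0 leb_outerE outer_measure0. Qed.

Lemma lam_bigcup K (A : nat -> set R) (e : R) :
  (forall i, (i < K)%N -> lam (A i) <= e) ->
  lam [set t | exists2 i, (i < K)%N & A i t] <= e *+ K.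
Proof.
elim: K => [|K IH] h.
  by rewrite mulr0n -lam0; apply: lam_le => t _ [].
rewrite mulrSr; apply: (@le_trans _ _
    (lam ([set t | exists2 i, (i < K)%N & A i t] `|` A K))).
  apply: lam_le => t _ [i]; rewrite ltnS leq_eqVlt => /predU1P[->|iK] Ait.
    by right.
  by left; exists i.
apply: (le_trans (lamU _ _)); apply: lerD; last exact: h.
by apply: IH => i iK; apply: h; rewrite ltnS ltnW.
Qed.

(** Used to pick points outside exceptional sets once these are known to be small. *)
Lemma lam_exists A B : lam B < lam A -> exists t, [/\ unitI t, A t & ~ B t].
Proof.
move=> BA; apply: contrapT => h; move: BA; apply/negP; rewrite -leNgt.
apply: lam_le => t It At; apply: contrapT => Bt; apply: h; by exists t.
Qed.

(** Admissibility of [e] in the Ky Fan infimum, which avoids asking whether that infimum is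
    attained. *)
Definition close (e : R) u v := lam [set t | e < `|u t - v t|] <= e.

Lemma kyfan_lbound u v : lbound [set e : R | 0 <= e /\
    ((@lebesgue_measure R) (@unitI R `&` [set x | (e < `|u x - v x|)%R]) <= e%:E)%E] 0.
Proof. by move=> e []. Qed.

Lemma kyfan_ge0 u v : 0 <= kyfan u v.
Proof.
apply: lb_le_inf; last exact: kyfan_lbound.
by exists 1; split => //; rewrite lamE lee_fin lam_le1.
Qed.

Lemma close_kyfan e u v : 0 <= e -> close e u v -> kyfan u v <= e.
Proof.
move=> e0 c; apply: ge_inf; first by exists 0; exact: kyfan_lbound.
by split => //; rewrite lamE lee_fin.
Qed.

Lemma kyfan_le1 u v : kyfan u v <= 1.
Proof. by apply: close_kyfan => //; exact: lam_le1. Qed.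

Lemma kyfan_close e u v : kyfan u v < e -> close e u v.
Proof.
move=> /inf_lt[|e' [e'0]].
  by exists 1; split => //; rewrite lamE lee_fin lam_le1.
rewrite lamE lee_fin => h e'e; rewrite /close (le_trans _ (ltW e'e))//.
apply: le_trans h; apply: lam_le => t _ /=; exact: lt_trans.
Qed.

(** Nonemptiness and [kyfan_le1] ensure that no supremum or infimum takes its default value. *)
Lemma hausdorff_close (A B : set (R -> R)) e : A !=set0 -> B !=set0 ->
  hausdorff_kf A B < e ->
  (forall a, A a -> exists2 b, B b & close e a b) /\
  (forall b, B b -> exists2 a, A a & close e a b).
Proof.
move=> A0 B0; rewrite /hausdorff_kf gt_max => /andP[h1 h2]; split.
  move=> a Aa; have : inf [set kyfan a b | b in B] < e.
    apply: le_lt_trans h1; apply: ub_le_sup; last by exists a.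
    exists 1 => _ [c _ <-]; case: B0 => b Bb.
    apply: le_trans (kyfan_le1 c b); apply: ge_inf; last by exists b.
    by exists 0 => _ [b' _ <-]; exact: kyfan_ge0.
  move=> /inf_lt[]; first by case: B0 => b Bb; eexists; exists b.
  by move=> _ [b Bb <-] /kyfan_close; exists b.
move=> b Bb; have : inf [set kyfan a b | a in A] < e.
  apply: le_lt_trans h2; apply: ub_le_sup; last by exists b.
  exists 1 => _ [c _ <-]; case: A0 => a Aa.
  apply: le_trans (kyfan_le1 a c); apply: ge_inf; last by exists a.
  by exists 0 => _ [b' _ <-]; exact: kyfan_ge0.
move=> /inf_lt[]; first by case: A0 => a Aa; eexists; exists a.
by move=> _ [a Aa <-] /kyfan_close; exists a.
Qed.

Lemma close_hausdorff (A B : set (R -> R)) e : 0 <= e -> A !=set0 -> B !=set0 ->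
  (forall a, A a -> exists2 b, B b & close e a b) ->
  (forall b, B b -> exists2 a, A a & close e a b) ->
  hausdorff_kf A B <= e.
Proof.
move=> e0 A0 B0 h1 h2; rewrite /hausdorff_kf ge_max; apply/andP; split.
  apply: ge_sup; first by case: A0 => a Aa; eexists; exists a.
  move=> _ [a Aa <-]; have [b Bb /(close_kyfan e0)] := h1 _ Aa.
  apply: le_trans; apply: ge_inf; last by exists b.
  by exists 0 => _ [b' _ <-]; exact: kyfan_ge0.
apply: ge_sup; first by case: B0 => a Aa; eexists; exists a.
move=> _ [b Bb <-]; have [a Aa /(close_kyfan e0)] := h2 _ Bb.
apply: le_trans; apply: ge_inf; last by exists a.
by exists 0 => _ [b' _ <-]; exact: kyfan_ge0.
Qed.

Lemma hausdorff_ge0 (A B : set (R -> R)) : 0 <= hausdorff_kf A B.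
Proof.
rewrite /hausdorff_kf le_max; apply/orP; left.
have [->|/set0P[a Aa]] := eqVneq A set0; first by rewrite image_set0 sup0.
have [B0|/set0P[b0 Bb0]] := eqVneq B set0.
  rewrite (_ : [set _ | _ in _] = [set 0]) ?sup1//; apply/seteqP; split.
    by move=> _ [c _ <-]; rewrite B0 image_set0 inf0.
  by move=> _ ->; exists a => //; rewrite B0 image_set0 inf0.
have inf_ge0 c : 0 <= inf [set kyfan c b | b in B].
  apply: lb_le_inf; first by eexists; exists b0.
  by move=> _ [b' _ <-]; exact: kyfan_ge0.
apply: (le_trans (inf_ge0 a)); apply: ub_le_sup; last by exists a.
exists 1 => _ [c _ <-].
apply: le_trans (kyfan_le1 c b0); apply: ge_inf; last by exists b0.
by exists 0 => _ [b' _ <-]; exact: kyfan_ge0.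
Qed.

End OuterMeasure.

Section ObservableDistance.
Context {R : realType}.
Implicit Types X Y : mmspace R.

Definition param_close X Y (phi : R -> mm_T X) (psi : R -> mm_T Y) (e : R) :=
  (forall f, lip1 X f -> exists2 g, lip1 Y g & close e (f \o phi) (g \o psi)) /\
  (forall g, lip1 Y g -> exists2 f, lip1 X f & close e (f \o phi) (g \o psi)).

Lemma lip1_cst X (c : R) : is_metric (mm_dist X) -> lip1 X (fun=> c).
Proof. by move=> mX x y; rewrite subrr normr0; exact: metric_ge0. Qed.

Let param_dists X Y : set R :=
  [set hausdorff_kf [set f \o pp.1 | f in lip1 X] [set g \o pp.2 | g in lip1 Y]
      | pp in [set pp : (R -> mm_T X) * (R -> mm_T Y) |
               is_parameter X pp.1 /\ is_parameter Y pp.2]].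

Let param_dists_lbound X Y : lbound (param_dists X Y) 0.
Proof. by move=> _ [pp _ <-]; exact: hausdorff_ge0. Qed.

Lemma dconc_ge0 X Y : 0 <= dconc X Y.
Proof.
rewrite /dconc -/(param_dists X Y).
have [->|/set0P h] := eqVneq (param_dists X Y) set0; first by rewrite inf0.
exact: lb_le_inf.
Qed.

Lemma dconc_param_close X Y e :
  is_metric (mm_dist X) -> is_metric (mm_dist Y) ->
  (exists phi psi, is_parameter X phi /\ is_parameter Y psi) ->
  dconc X Y < e ->
  exists phi psi, [/\ is_parameter X phi, is_parameter Y psi &
    param_close phi psi e].
Proof.
move=> mX mY [phi0 [psi0 p0]] dXY.
have [|r [[phi psi] [p1 p2] <-]] := inf_lt _ dXY.
  by eexists; exists (phi0, psi0).
move=> /hausdorff_close[].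
- by eexists; exists (fun=> 0) => //; exact: lip1_cst.
- by eexists; exists (fun=> 0) => //; exact: lip1_cst.
move=> h1 h2; exists phi, psi; split => //; split.
- by move=> f Lf; have [|b [g Lg <-] c] := h1 (f \o phi); [exists f|exists g].
- by move=> g Lg; have [|b [f Lf <-] c] := h2 (g \o psi); [exists g|exists f].
Qed.

Lemma param_close_dconc X Y phi psi e :
  is_metric (mm_dist X) -> is_metric (mm_dist Y) -> 0 <= e ->
  is_parameter X phi -> is_parameter Y psi -> param_close phi psi e ->
  dconc X Y <= e.
Proof.
move=> mX mY e0 p1 p2 [h1 h2].
apply: (@le_trans _ _ (hausdorff_kf [set f \o phi | f in lip1 X]
    [set g \o psi | g in lip1 Y])).
  apply: ge_inf; first by exists 0; exact: param_dists_lbound.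
  by exists (phi, psi).
apply: close_hausdorff => //.
- by eexists; exists (fun=> 0) => //; exact: lip1_cst.
- by eexists; exists (fun=> 0) => //; exact: lip1_cst.
- by move=> _ [f Lf <-]; have [g Lg c] := h1 _ Lf; exists (g \o psi) => //; exists g.
- by move=> _ [g Lg <-]; have [f Lf c] := h2 _ Lg; exists (f \o phi) => //; exists f.
Qed.

(** The empty infimum is 0, so a missing parameter makes the distance vanish and existence of
    parameters need not be shown in general. *)
Lemma dconc_no_param X Y :
  ~ (exists phi psi, is_parameter X phi /\ is_parameter Y psi) -> dconc X Y = 0.
Proof.
move=> h; rewrite /dconc -/(param_dists X Y) (_ : param_dists X Y = set0) ?inf0//.
by apply/seteqP; split => // r [[phi psi] p _]; apply: h; exists phi, psi.
Qed.

Lemma concentratesP (Xs : nat -> mmspace R) X : concentrates Xs X <->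
  forall e, 0 < e -> \forall n \near \oo, dconc (Xs n) X < e.
Proof.
split => [/cvgrPdist_lt h e e0|h].
  apply: filterS (h _ e0) => n /=.
  by rewrite sub0r normrN ger0_norm// dconc_ge0.
apply/cvgrPdist_lt => e e0; apply: filterS (h _ e0) => n /=.
by rewrite sub0r normrN ger0_norm// dconc_ge0.
Qed.

Lemma mp_is_metric (F : R -> R) X : metric_preserving F ->
  is_metric (mm_dist X) -> is_metric (mm_dist (mm_comp F X)).
Proof. by move=> [_ h] /h. Qed.

End ObservableDistance.

(** * Stability of closeness of Lipschitz functions *)

(** Balls around a dense sequence exhaust the space, and continuity of the measure leaves finitely
    many. The bound depends only on the law of [psi], so the cover can be fixed before the
    parameter. *)
Lemma mm_cover (R : realType) (X : mmspace R) (del eta : R) :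
  is_mm X -> 0 < del -> 0 < eta ->
  exists K (x : nat -> mm_T X), forall psi, is_parameter X psi ->
    lam [set t | ~ exists2 i, (i < K)%N & mm_dist X (x i) (psi t) < del] <= eta.
Proof.
move=> [[d0 [dC dt]] [_ [[S [cS dS]] mE]]] del0 eta0.
have [S0|/unsquash s] := pfcard_geP cS.
  by have [y] := dS point 1 ltr01; rewrite S0.
pose B i := [set y | mm_dist X (s i) y < del].
have mB i : measurable (B i).
  rewrite mE; apply: sub_sigma_algebra => y By.
  exists (del - mm_dist X (s i) y) => [|z yz]; first by rewrite subr_gt0.
  by apply: (le_lt_trans (dt _ y _)); rewrite -ltrBrDl.
pose A k := \bigcup_(i in `I_k) B i.
have mA k : measurable (A k) by exact: bigcup_measurable.
have AT : \bigcup_k A k = setT.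
  apply/seteqP; split => // y _; have [z Sz yz] := dS y _ del0.
  have [i _ siz] := @surj _ _ _ _ s _ Sz; exists i.+1 => //; exists i => //=.
  by rewrite /B /= siz dC.
have : mm_meas X (A k) @[k --> \oo] --> mm_meas X (\bigcup_k A k).
  apply: nondecreasing_cvg_mu => //.
  - by rewrite AT.
  - move=> k l kl; apply/subsetPset => y [i /= ik By]; exists i => //=.
    exact: leq_trans ik kl.
rewrite AT probability_setT => /fine_cvgP[_ /cvgrPdist_lt/(_ _ eta0)[K _ hK]].
exists K, s => psi [_ psiP].
have -> : [set t | ~ exists2 i, (i < K)%N & mm_dist X (s i) (psi t) < del]
    = psi @^-1` (~` A K).
  apply/seteqP; split => t /= h [i iK Bi]; apply: h; exists i => //.
rewrite -lee_fin -lamE psiP; last exact: measurableC.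
rewrite probability_setC// -[mm_meas X (A K)]fineK ?fin_num_measure//.
rewrite -EFinB lee_fin.
have /= := hK K (leqnn K); move=> /ltW; apply: le_trans; exact: ler_norm.
Qed.

Section Stability.
Context {R : realType} {X Y : mmspace R} {F G : R -> R}.
Variables (phi : R -> mm_T Y) (psi : R -> mm_T X).
(** [eta] is the precision, [d0] a scale at which [F] and [G] are small, [del] the radius of the
    balls, [thr] the mass below which a ball is discarded, [eps] the closeness of 1-Lipschitz
    functions. *)
Variables (eta d0 del thr eps : R) (K : nat) (x : nat -> mm_T X).
Let dX := mm_dist X.
Let dY := mm_dist Y.
Hypotheses (mX : is_metric dX) (mY : is_metric dY).
Hypotheses (mpF : metric_preserving F) (mpG : metric_preserving G).
Hypotheses (eta_gt0 : 0 < eta) (d0_gt0 : 0 < d0) (delE : del * 8 = d0).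
Hypotheses (Fd0 : F d0 <= eta) (Gd0 : G d0 <= eta).
Hypotheses (eps_gt0 : 0 < eps) (eps_del : eps <= del) (eps_eta : eps *+ K.+1 <= eta).
Hypotheses (eps_thr : eps *+ K.+3 <= thr) (thr_eta : thr *+ K <= eta).
Hypothesis cover :
  lam [set t | ~ exists2 i, (i < K)%N & dX (x i) (psi t) < del] <= eta.
Hypothesis FG : forall i j, (i < K)%N -> (j < K)%N ->
  `|G (dX (x i) (x j)) - F (dX (x i) (x j))| <= eta.
Hypothesis Gmono : forall i j, (i < K)%N -> (j < K)%N ->
  forall t, Num.max 0 (dX (x i) (x j) - del * 4) <= t ->
  G (Num.max 0 (dX (x i) (x j) - del * 4)) - eta <= G t.
Hypothesis pc : param_close phi psi eps.

Let dX_ge0 y z : 0 <= dX y z. Proof. exact: metric_ge0. Qed.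
Let dY_ge0 y z : 0 <= dY y z. Proof. exact: metric_ge0. Qed.
Let dXC y z : dX y z = dX z y. Proof. by case: mX => _ []. Qed.
Let dXt y z w : dX y w <= dX y z + dX z w. Proof. by case: mX => _ [_]; exact. Qed.

Let small (H : R -> R) : metric_preserving H -> H d0 <= eta ->
  forall u, 0 <= u -> u <= d0 * 2 -> H u <= eta * 2.
Proof.
by move=> mpH Hd u u0 ud; have := mp_le2 mpH u0 ud; lra.
Qed.

Let J i := [set t | dX (x i) (psi t) < del].

Let lip_dist z : lip1 X (dX z).
Proof.
move=> y w; rewrite -/dX ler_norml; apply/andP; split.
  by have := dXt z y w; lra.
by have := dXt z w y; rewrite (dXC w y); lra.
Qed.

(* [fi i] transports [dX (x i)] to [Y]; it bounds distances in [Y] from below. *)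
Let fi i : mm_T Y -> R := projT1 (cid2 (pc.2 _ (lip_dist (x i)))).
Let fi_lip i : lip1 Y (fi i). Proof. by rewrite /fi; case: cid2. Qed.
Let fi_close i : close eps (fi i \o phi) (dX (x i) \o psi).
Proof. by rewrite /fi; case: cid2. Qed.

Let E := [set t | exists2 i, (i < K)%N & eps < `|fi i (phi t) - dX (x i) (psi t)|].

Let lamE_le : lam E <= eps *+ K.
Proof. by apply: lam_bigcup => i _; exact: fi_close. Qed.

(** The 1-Lipschitz [fi i] is at most [del + eps] at [phi t] and at least
    [dX (x i) (x j) - del - eps] at [phi u]; [eps <= del] gives the constant 4. *)
Let dist_lb i j t u : (i < K)%N -> J i t -> ~ E t -> J j u -> ~ E u ->
  dX (x i) (x j) - del * 4 <= dY (phi u) (phi t).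
Proof.
rewrite /J /= => iK Jt Et Ju Eu.
have h v : ~ E v -> `|fi i (phi v) - dX (x i) (psi v)| <= eps.
  by move=> Ev; rewrite leNgt; apply/negP => h; apply: Ev; exists i.
have := h _ Et; have := h _ Eu; rewrite !ler_norml => /andP[h1 _] /andP[_ h2].
have := @fi_lip i (phi u) (phi t); rewrite ler_norml => /andP[_].
rewrite -/dY.
have := dXt (x i) (psi u) (x j); rewrite (dXC (psi u)).
have := eps_del; lra.
Qed.

Lemma stability_backward (g : mm_T X -> R) : lip1 (mm_comp F X) g ->
  exists2 f, lip1 (mm_comp G Y) f & close (eta * 17) (f \o phi) (g \o psi).
Proof.
move=> Lg; have LgF y z : `|g y - g z| <= F (dX y z) by exact: Lg.
have [hd0 [he0 [hdE hee]]] := conj d0_gt0 (conj eta_gt0 (conj delE eps_del)).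
pose S : set (mm_T Y * R) := [set p | exists i t,
  [/\ (i < K)%N, J i t, ~ E t & p = (phi t, g (x i))]].
have mGY : is_metric (fun y z => G (dY y z)) by exact: (mp_is_metric mpG mY).
have [m Sm] : exists m : mm_T Y -> R,
    forall y p, S p -> m y <= p.2 + G (dY y p.1).
  apply: (@infconv_fin_bound _ _ _ mGY K (g \o x)).
  by move=> _ [i [t [iK _ _ ->]]]; exists i.
exists (infconv (rho := fun y z => G (dY y z)) S).
  by move=> y z; exact: (infconv_lip mGY y z Sm).
apply: (@le_trans _ _ (lam ([set t | ~ exists2 i, (i < K)%N & dX (x i) (psi t) < del] `|` E))).
  apply: lam_le => t _; apply: contraPP => /not_orP[/contrapT[j jK Jt] Et] /=.
  apply/negP; rewrite -leNgt.
  have up : infconv (rho := fun y z => G (dY y z)) S (phi t) <= g (x j).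
    have := @infconv_le _ _ (fun y z => G (dY y z)) S m (phi t, g (x j)) (phi t) Sm.
    rewrite /= (mY.1 _ _).2// (mp0 mpG) addr0; apply.
    by exists j, t.
  (* The four [eta]: one from [Gmono], two from replacing [s] by [dX (x i) (x j)] in [G], one from
     replacing [G] by [F]. *)
  have lo : g (x j) - eta * 4 <= infconv (rho := fun y z => G (dY y z)) S (phi t).
    apply: infconv_ge; first by exists (phi t, g (x j)); exists j, t.
    move=> _ [i [u [iK Ju Eu ->]]] /=.
    have D0 := dX_ge0 (x i) (x j).
    have lb : Num.max 0 (dX (x i) (x j) - del * 4) <= dY (phi t) (phi u).
      by rewrite ge_max dY_ge0 (@dist_lb i j).
    have := Gmono iK jK lb.
    set s := Num.max _ _.
    have s0 : 0 <= s by rewrite le_max lexx.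
    have s1 : dX (x i) (x j) - del * 4 <= s by rewrite le_max lexx orbT.
    have s2 : s <= dX (x i) (x j) by rewrite ge_max D0/=; lra.
    have := mp_dist mpG D0 s0; rewrite ger0_norm ?subr_ge0//.
    have := @small _ mpG Gd0 (dX (x i) (x j) - s).
    have := FG iK jK; rewrite ler_norml => /andP[h1 _].
    have := LgF (x i) (x j); rewrite ler_norml => /andP[h2 _] /=.
    move=> h3; have {}h3 := h3 ltac:(lra) ltac:(lra).
    lra.
  have := LgF (x j) (psi t); rewrite ler_norml => /andP[h1 h2].
  have := @small _ mpF Fd0 (dX (x j) (psi t)) (dX_ge0 _ _) ltac:(rewrite /J /= in Jt; lra).
  rewrite ler_norml /comp; lra.
apply: (le_trans (lamU _ _)); have := lerD cover lamE_le.
have : eps *+ K <= eps *+ K.+1 by rewrite mulrS lerDr ltW.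
have := eps_eta; lra.
Qed.

(** The constant 17 is 4 ([f] against [a j] on [J j]), plus 11 (defect of the values [a] in [aF]),
    plus 2 (from [x j] to [psi t]). *)
Lemma stability_forward (f : mm_T Y -> R) : lip1 (mm_comp G Y) f ->
  exists2 g, lip1 (mm_comp F X) g & close (eta * 17) (f \o phi) (g \o psi).
Proof.
move=> Lf; have LfG y z : `|f y - f z| <= G (dY y z) by exact: Lf.
have [hd0 [he0 [hdE hee]]] := conj d0_gt0 (conj eta_gt0 (conj delE eps_del)).
(* The slope in [mp_linear]; then [C * del] is [eta / 4], so a [C]-Lipschitz function hardly varies
   on a ball of radius [del]. *)
pose C := eta * 2 / d0.
have C0 : 0 < C by rewrite divr_gt0// mulr_gt0.
have Cdel : C * del <= eta.
  have del0 : del != 0 by apply/eqP => h; move: hdE; rewrite h; lra.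
  have -> : C * del = eta / 4 by rewrite /C -delE; field.
  lra.
have [|ft [ftL ftf]] := @lip_regularization _ _ dY f (eta * 2) C mY C0.
  move=> y z; apply: (le_trans (LfG y z)); exact: mp_linear.
have [|q Lq qc] := pc.1 (fun y => ft y / C).
  move=> y z; rewrite -mulrBl normrM (gtr0_norm (_ : 0 < C^-1)) ?invr_gt0//.
  by rewrite ler_pdivrMr// mulrC; exact: ftL.
pose E0 := [set t | eps < `|ft (phi t) / C - q (psi t)|].
pose a i := C * q (x i).
have fa i t : J i t -> ~ E0 t -> `|f (phi t) - a i| <= eta * 4.
  rewrite /J /E0 /= => Jt /negP; rewrite -leNgt => h1.
  have h2 : `|ft (phi t) - C * q (psi t)| <= eta.
    have -> : ft (phi t) - C * q (psi t) = C * (ft (phi t) / C - q (psi t)).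
      by field; rewrite gt_eqF.
    rewrite normrM gtr0_norm//; apply: le_trans Cdel.
    by rewrite ler_pM2l//; lra.
  have h3 : `|C * q (psi t) - a i| <= eta.
    rewrite /a -mulrBr normrM gtr0_norm//; apply: le_trans Cdel.
    rewrite ler_pM2l//; apply: (le_trans (Lq _ _)).
    by rewrite -/dX dXC ltW.
  have := ftf (phi t); move: h2 h3; rewrite !ler_norml; lra.
(* Only balls heavy enough to survive the removal of the exceptional sets are used; the others have
   total mass at most [thr *+ K]. *)
pose fat i := (i < K)%N /\ thr < lam (J i).
have aF i j : fat i -> fat j -> a i - a j <= F (dX (x i) (x j)) + eta * 11.
  move=> [iK fi_] [jK fj].
  (* The distance in [Y] to the image of the good part of [J i] is transported to [r] on [X]. As [r]
     is nearly 0 at a point of [J i] and 1-Lipschitz, it is at most about [dX (x i) (x j)] on [J j];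
     this yields [t] and [u] whose images in [Y] are about that far apart. *)
  pose A := [set t | J i t /\ ~ (E `|` E0) t].
  pose S : set (mm_T Y * R) := [set (phi t, 0) | t in A].
  have Sm y p : S p -> 0 <= p.2 + dY y p.1.
    by move=> [t _ <-] /=; rewrite add0r.
  have [|r Lr rc] := pc.1 (infconv (rho := dY) S).
    by move=> y z; exact: (infconv_lip mY y z Sm).
  pose E1 := [set t | eps < `|infconv (rho := dY) S (phi t) - r (psi t)|].
  (* [E] costs [eps *+ K], [E0] and [E1] cost [eps] each; the last [eps] in [eps *+ K.+3] makes the
     inequality strict. *)
  have EE : lam ((E `|` E0) `|` E1) < thr.
    apply: (le_lt_trans (lamU _ _)); have := lamU E E0; have := lamE_le.
    have := qc; have := rc; rewrite /close -/E0 -/E1.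
    have : eps *+ K.+3 = eps *+ K + eps + eps + eps by rewrite !mulrSr.
    have := eps_thr; have := eps_gt0; lra.
  have [t0 [_ Jt0 /not_orP[Et0 E1t0]]] := lam_exists (lt_trans EE fi_).
  have [u [_ Ju /not_orP[Eu E1u]]] := lam_exists (lt_trans EE fj).
  have At0 : S (phi t0, 0) by exists t0.
  have p0 := infconv_le (phi t0) Sm At0.
  rewrite /= (mY.1 _ _).2// addr0 in p0.
  have p1 : infconv (rho := dY) S (phi t0) >= 0.
    by apply: infconv_ge; [exists (phi t0, 0)|exact: Sm].
  move: E1t0 E1u; rewrite /E1 /= => /negP; rewrite -leNgt ler_norml => /andP[e1 e2].
  move=> /negP; rewrite -leNgt ler_norml => /andP[e3 e4].
  have := Lr (psi u) (psi t0); rewrite ler_norml -/dX => /andP[_ e5].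
  move: Jt0 Ju; rewrite /J /= => Jt0 Ju.
  have e6 := dXt (psi u) (x j) (psi t0); rewrite (dXC (psi u) (x j)) in e6.
  have e7 := dXt (x j) (x i) (psi t0); rewrite (dXC (x j) (x i)) in e7.
  have : infconv (rho := dY) S (phi u) < dX (x i) (x j) + del * 6 by lra.
  move=> /inf_lt[|_ [_ [t [Jt /not_orP[Et E0t]] <-] <-]] /=.
    by eexists; exists (phi t0, 0).
  rewrite add0r => ub.
  have lb := @dist_lb i j t u iK Jt Et Ju (fun h => Eu (or_introl h)).
  have D0 := dX_ge0 (x i) (x j).
  have := mp_dist mpG (dY_ge0 (phi u) (phi t)) D0.
  have := @small _ mpG Gd0 `|dY (phi u) (phi t) - dX (x i) (x j)| (normr_ge0 _).
  have nd : `|dY (phi u) (phi t) - dX (x i) (x j)| <= d0 * 2.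
    by rewrite ler_norml; lra.
  move=> /(_ nd).
  have := FG iK jK; rewrite ler_norml => /andP[_ h1].
  have := fa i t Jt E0t; have := fa j u Ju (fun h => Eu (or_intror h)).
  rewrite !ler_norml => /andP[h2 h3] /andP[h4 h5].
  have := LfG (phi u) (phi t); rewrite ler_norml => /andP[h6 h7].
  lra.
pose S : set (mm_T X * R) := [set (x i, a i) | i in fat].
have mFX : is_metric (fun y z => F (dX y z)) by exact: (mp_is_metric mpF mX).
have [m Sm] : exists m : mm_T X -> R,
    forall y p, S p -> m y <= p.2 + F (dX y p.1).
  apply: (@infconv_fin_bound _ _ _ mFX K a).
  by move=> _ [i [iK _] <-]; exists i.
have gL y z := infconv_lip mFX y z Sm.
exists (infconv (rho := fun y z => F (dX y z)) S) => //.
apply: (@le_trans _ _ (lam (([set t | ~ exists2 i, (i < K)%N &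
    dX (x i) (psi t) < del] `|` E0) `|`
    [set t | exists2 i, (i < K)%N & (J i t /\ lam (J i) <= thr)]))).
  apply: lam_le => t _; apply: contraPP.
  move=> /not_orP[/not_orP[/contrapT[j jK Jt] E0t] thin] /=.
  apply/negP; rewrite -leNgt.
  have fatj : fat j.
    by split => //; rewrite ltNge; apply/negP => h; apply: thin; exists j.
  have Sj : S (x j, a j) by exists j.
  have up := @infconv_le _ _ (fun y z => F (dX y z)) _ _ _ (x j) Sm Sj.
  rewrite /= (mX.1 _ _).2// (mp0 mpF) addr0 in up.
  have lo : a j - eta * 11 <= infconv (rho := fun y z => F (dX y z)) S (x j).
    apply: infconv_ge; first by exists (x j, a j).
    by move=> _ [i fati <-] /=; have := aF j i fatj fati; lra.
  have := gL (x j) (psi t); have := fa j t Jt E0t; rewrite !ler_norml.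
  have := @small _ mpF Fd0 (dX (x j) (psi t)) (dX_ge0 _ _) ltac:(rewrite /J /= in Jt; lra).
  rewrite /comp; lra.
have thinB : lam [set t | exists2 i, (i < K)%N & (J i t /\ lam (J i) <= thr)] <=
    thr *+ K.
  apply: (@lam_bigcup _ _ (fun i => [set t | J i t /\ lam (J i) <= thr])) => i _.
  have [h|h] := leP (lam (J i)) thr.
    by apply: le_trans h; apply: lam_le => t _ [].
  (* For a heavy ball the side condition fails and the set is empty. *)
  apply: (@le_trans _ _ (lam set0)).
    by apply: lam_le => t _ [].
  by rewrite lam0 (le_trans _ eps_thr)// mulrn_wge0// ltW.
apply: (le_trans (lamU _ _)).
have := lamU [set t | ~ exists2 i, (i < K)%N & dX (x i) (psi t) < del] E0.
have : eps <= eps *+ K.+1 by rewrite mulrSr lerDr mulrn_wge0// ltW.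
have := qc; rewrite /close -/E0.
have := eps_eta; have := thr_eta; have := cover; lra.
Qed.

Lemma stability :
  param_close (X := mm_comp G Y) (Y := mm_comp F X) phi psi (eta * 17).
Proof. by split; [exact: stability_forward|exact: stability_backward]. Qed.

End Stability.

(** * Asymptotic monotonicity implies stability of concentration *)

Lemma mp_inf_le (R : realType) (F : R -> R) (s t : R) : metric_preserving F ->
  0 <= s -> s <= t -> inf [set F u | u in [set u | s <= u]] <= F t.
Proof.
move=> mpF s0 st; apply: ge_inf; last by exists t.
by exists 0 => _ [u /= su <-]; apply: (mp_ge0 mpF); exact: le_trans su.
Qed.

(** The finite cover of [X] is fixed before [n], so pointwise convergence and condition (2) are
    needed only at the finitely many values [dist i j], [s i j] and [d0]. *)
Lemma asymptotic_mono_concentrates (R : realType) (Fs : nat -> R -> R) (F : R -> R) :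
  (forall n, metric_preserving (Fs n)) -> cont_metric_preserving F ->
  (forall s, 0 <= s -> Fs n s @[n --> \oo] --> F s) ->
  (forall s, 0 <= s ->
    (Fs n s - inf [set Fs n t | t in [set t | s <= t]]) @[n --> \oo] --> 0) ->
  forall (Xs : nat -> mmspace R) (X : mmspace R),
    (forall n, is_mm (Xs n)) -> is_mm X -> concentrates Xs X ->
    concentrates (fun n => mm_comp (Fs n) (Xs n)) (mm_comp F X).
Proof.
move=> mpFs cF FsF mono Xs X mmXs mmX /concentratesP conc.
apply/concentratesP => e e0.
pose eta := e / 18.
have eta0 : 0 < eta by rewrite divr_gt0.
have [d0 d00 Fd0] := cont_mp_small cF eta0.
pose del := d0 / 8.
have del0 : 0 < del by rewrite divr_gt0.
have [K [x cover]] := mm_cover mmX del0 eta0.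
pose thr := eta / K.+1%:R.
have thr0 : 0 < thr by rewrite divr_gt0.
have thrE : thr *+ K.+1 = eta by rewrite -mulr_natr divfK// pnatr_eq0.
pose eps := Num.min del (thr / (K.+3)%:R).
have eps0 : 0 < eps by rewrite lt_min del0 divr_gt0.
have eps_del : eps <= del by rewrite ge_min lexx.
have eps_thr : eps *+ K.+3 <= thr.
  by rewrite -mulr_natr -ler_pdivlMr// ge_min lexx orbT.
have thr_eta : thr *+ K <= eta by rewrite -thrE mulrS lerDr ltW.
have eps_eta : eps *+ K.+1 <= eta.
  have : thr <= eta by rewrite -thrE mulrS lerDl mulrn_wge0// ltW.
  apply: le_trans; apply: le_trans eps_thr.
  by rewrite ler_pMn2l// ltnS leqW.
pose dist (i j : 'I_K) := mm_dist X (x i) (x j).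
have mX : is_metric (mm_dist X) by case: mmX.
have dist0 i j : 0 <= dist i j by exact: (metric_ge0 mX).
pose s (i j : 'I_K) := Num.max 0 (dist i j - del * 4).
have s0 i j : 0 <= s i j by rewrite le_max lexx.
have FG : \forall n \near \oo, forall i j, `|Fs n (dist i j) - F (dist i j)| <= eta.
  apply: filter_forall => i; apply: filter_forall => j.
  have /cvgrPdist_le/(_ _ eta0) := FsF _ (dist0 i j).
  by apply: filterS => n; rewrite distrC.
have Gm : \forall n \near \oo, forall i j,
    Fs n (s i j) - inf [set Fs n t | t in [set t | s i j <= t]] <= eta.
  apply: filter_forall => i; apply: filter_forall => j.
  have /cvgrPdist_le/(_ _ eta0) := mono _ (s0 i j).
  apply: filterS => n; rewrite sub0r normrN; exact/le_trans/ler_norm.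
have Gd0 : \forall n \near \oo, Fs n d0 <= eta.
  exact: cvgr_le (FsF _ (ltW d00)) _ Fd0.
near=> n.
apply: (@le_lt_trans _ _ (eta * 17)); last by rewrite /eta; lra.
have mXn : is_metric (mm_dist (Xs n)) by case: (mmXs n).
have mXn' := mp_is_metric (mpFs n) mXn.
have mX' := mp_is_metric cF.1 mX.
have [par|npar] := pselect (exists phi psi,
    is_parameter (Xs n) phi /\ is_parameter X psi); last first.
  by rewrite dconc_no_param ?mulr_ge0// ltW.
have [phi [psi [pphi ppsi pc]]] : exists phi psi,
    [/\ is_parameter (Xs n) phi, is_parameter X psi & param_close phi psi eps].
  by apply: dconc_param_close => //; near: n; exact: conc.
apply: (@param_close_dconc _ (mm_comp (Fs n) (Xs n)) (mm_comp F X) phi psi (eta * 17)) => //.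
  by rewrite mulr_ge0// ltW.
apply: (@stability _ _ _ _ _ _ _ eta d0 del thr eps K x) => //.
- exact: cF.1.
- by rewrite /del divfK.
- exact: ltW.
- by near: n.
- exact: cover.
- move=> i j iK jK.
  have : forall i j, `|Fs n (dist i j) - F (dist i j)| <= eta by near: n.
  exact: (fun h => h (Ordinal iK) (Ordinal jK)).
- move=> i j iK jK t st.
  have : forall i j, Fs n (s i j) - inf [set Fs n t | t in [set t | s i j <= t]] <= eta.
    by near: n.
  move=> /(_ (Ordinal iK) (Ordinal jK)).
  have := @mp_inf_le _ (Fs n) (s (Ordinal iK) (Ordinal jK)) t (mpFs n) (s0 _ _) st.
  by rewrite /s /dist /=; lra.
Unshelve. all: by end_near. Qed.

(** * Finite mm-spaces with the uniform measure *)

Section UniformParameter.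
Context {R : realType} (T : finType) (x0 : T).

(** Cuts [0, 1) into equal intervals, one for each element in the order of [enum T]. *)
Definition unif_param (t : R) : T := nth x0 (enum T) (Num.truncn (t * #|T|%:R)).

Let cardT_gt0 : (0 : R) < #|T|%:R.
Proof. by rewrite ltr0n; apply/card_gt0P; exists x0. Qed.

Lemma unif_param_fiber x : @unitI R `&` unif_param @^-1` [set x] =
  [set` `[(enum_rank x)%:R / #|T|%:R, (enum_rank x).+1%:R / #|T|%:R[].
Proof.
have enumT_size : size (enum T) = #|T| by rewrite cardT.
apply/seteqP; split => t /=; rewrite /unitI/= !in_itv/=.
  move=> [/andP[t0 t1] tx].
  have tn0 : 0 <= t * #|T|%:R by rewrite mulr_ge0// ltW.
  have /andP[k1 k2] := truncn_itv tn0.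
  have kn : (Num.truncn (t * #|T|%:R) < #|T|)%N.
    by rewrite -(ltr_nat R) (le_lt_trans k1)// gtr_pMl.
  have -> : nat_of_ord (enum_rank x) = Num.truncn (t * #|T|%:R).
    rewrite -tx /unif_param -(enum_val_nth x0 (Ordinal kn)).
    by rewrite enum_valK.
  by rewrite ler_pdivrMr// ltr_pdivlMr// k1 k2.
rewrite ler_pdivrMr// ltr_pdivlMr// => /andP[k1 k2].
have t0 : 0 <= t.
  by rewrite -(pmulr_lge0 _ cardT_gt0) (le_trans _ k1).
split.
  rewrite t0/= -(ltr_pM2r cardT_gt0) mul1r (lt_le_trans k2)// ler_nat.
  exact: ltn_ord.
rewrite /unif_param (_ : Num.truncn _ = enum_rank x) ?nth_enum_rank//.
by apply: truncn_def; rewrite k1 k2.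
Qed.

Let fib (A : set T) x := if x \in A then @unitI R `&` unif_param @^-1` [set x] else set0.

Let fibE A : @unitI R `&` unif_param @^-1` A = \bigcup_(x in setT) fib A x.
Proof.
apply/seteqP; split => t.
  by move=> [It At]; exists (unif_param t) => //; rewrite /fib mem_set.
by move=> [x _]; rewrite /fib; case: ifPn => // /set_mem Ax [It /= tx]; rewrite -tx in Ax.
Qed.

Let fib_measurable A x : measurable (fib A x : set (measurableTypeR R)).
Proof. by rewrite /fib; case: ifP => // _; rewrite unif_param_fiber. Qed.

Lemma unif_param_measurable A :
  measurable (@unitI R `&` unif_param @^-1` A : set (measurableTypeR R)).
Proof.
by rewrite fibE; apply: fin_bigcup_measurable => //; exact: finite_finset.
Qed.

Lemma lam_unif_param (A : set T) :
  lam (unif_param @^-1` A) = (\sum_x (x \in A)%:R) / #|T|%:R.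
Proof.
rewrite /lam fibE measure_fin_bigcup//=.
- have -> : [set: T] = [set` enum T].
    by apply/seteqP; split => // x _ /=; rewrite mem_enum.
  rewrite -fsbig_seq ?enum_uniq// big_enum /=; under eq_bigr => x _.
    have -> : lebesgue_measure (fib A x) = ((x \in A)%:R / #|T|%:R)%:E.
      rewrite /fib; case: ifP => _; last by rewrite measure0 mul0r.
      rewrite unif_param_fiber lebesgue_measure_itv /= lte_fin.
      rewrite ltr_pM2r ?invr_gt0// ltr_nat leqnn -EFinB -mulrBl.
      by rewrite -natrB ?leqnSn// subSnn.
    over.
  by rewrite sumEFin /= mulr_suml.
- move=> x y _ _ [t [Fx Fy]]; move: Fx Fy; rewrite /fib.
  by case: ifP => // _ [_ <-]; case: ifP => // _ [_ <-].
Qed.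

Lemma lam_unif_paramT : lam (unif_param @^-1` setT) = 1.
Proof.
by rewrite /lam preimage_setT setIT lebesgue_unitI.
Qed.

End UniformParameter.

Section FiniteSpace.
Context {R : realType} (T : finType) (x0 : T) (d : T -> T -> R).

Definition fin_pointed : pointedType := HB.pack_for pointedType (T : Type)
  (Choice.on T) (isPointed.Build T x0).

Definition fin_carrier := g_sigma_algebraType (dopen (d : fin_pointed -> fin_pointed -> R)).
HB.instance Definition _ := Measurable.on fin_carrier.

(** Defined as a push-forward, so that [unif_param] is a parameter by construction. *)
Definition fin_meas (A : set fin_carrier) : \bar R :=
  @lebesgue_measure R (@unitI R `&` unif_param x0 @^-1` A).

Let fin_meas0 : fin_meas set0 = 0%E.
Proof. by rewrite /fin_meas preimage_set0 setI0 measure0. Qed.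

Let fin_meas_ge0 A : (0 <= fin_meas A)%E.
Proof. exact: (outer_measure_ge0 leb_outer). Qed.

Let fin_meas_sigma_additive : semi_sigma_additive fin_meas.
Proof.
move=> A mA tA mUA; rewrite /fin_meas preimage_bigcup setI_bigcupr.
apply: measure_semi_sigma_additive.
- by move=> i; exact: unif_param_measurable.
- apply/trivIsetP => i j _ _ ij; rewrite setIACA setIid -preimage_setI.
  by have /trivIsetP/(_ i j I I ij) -> := tA; rewrite preimage_set0 setI0.
- by rewrite -setI_bigcupr -preimage_bigcup; exact: unif_param_measurable.
Qed.

HB.instance Definition _ := isMeasure.Build _ fin_carrier R fin_meas
  fin_meas0 fin_meas_ge0 fin_meas_sigma_additive.

Let fin_measT : fin_meas setT = 1%E.
Proof. by rewrite /fin_meas lamE lam_unif_paramT. Qed.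

HB.instance Definition _ := Measure_isProbability.Build _ fin_carrier R fin_meas fin_measT.

Definition fin_mm : mmspace R := @MMSpace R _ fin_carrier d fin_meas.

Hypothesis md : is_metric d.

(** A finite space has a least positive distance (1 serves if there is a single point). Hence every
    set is open, and Cauchy sequences are eventually constant. *)
Lemma fin_metric_discrete : exists2 e : R, 0 < e & forall x y, d x y < e -> x = y.
Proof.
exists (\big[Order.min/1]_(p : T * T | p.1 != p.2) d p.1 p.2).
  elim/big_ind: _ => // [a b a0 b0|[x y] /= xy].
    by rewrite lt_min a0 b0.
  rewrite lt0r (metric_ge0 md) andbT; apply: contra_neq xy; exact: (md.1 x y).1.
move=> x y; apply: contraPP => /eqP xy; apply/negP; rewrite -leNgt.
exact: (bigmin_le_cond 1 (fun p : T * T => d p.1 p.2) (xy : (x, y).1 != (x, y).2)).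
Qed.

Lemma fin_measurable (A : set (mm_T fin_mm)) : measurable A.
Proof.
have [e e0 he] := fin_metric_discrete.
by apply: sub_sigma_algebra => x Ax; exists e => // y /he <-.
Qed.

Lemma fin_mm_is_mm : is_mm fin_mm.
Proof.
have [e e0 he] := fin_metric_discrete.
split => //; split; [|split] => //.
- move=> u /(_ _ e0)[N hN]; exists (u N); apply: cvg_near_cst.
  exists N => // n /= Nn; apply/(md.1 _ _).2; apply: he; exact: hN.
- exists setT; split; first exact: (@countableP T).
  by move=> x r r0; exists x => //; rewrite /= (md.1 _ _).2.
Qed.

Lemma fin_mm_param : is_parameter fin_mm (unif_param x0).
Proof.
by split => // _ B _; exact: unif_param_measurable.
Qed.

Lemma fin_mm_meas (A : set (mm_T fin_mm)) :
  mm_meas fin_mm A = ((\sum_(x : T) (x \in (A : set T))%:R) / #|T|%:R)%:E.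
Proof. by rewrite -(lam_unif_param x0) -lamE. Qed.

End FiniteSpace.

(** * Concentration on the Hamming cube *)

(** Nested pairs let inductions on the dimension split off the first coordinate. *)
Fixpoint cube (N : nat) : finType :=
  if N is M.+1 then (bool * cube M)%type else unit.

Fixpoint ham (N : nat) : cube N -> cube N -> nat :=
  if N is M.+1 then fun x y => ((x.1 != y.1) + ham x.2 y.2)%N else fun _ _ => 0%N.

Fixpoint antipode (N : nat) : cube N -> cube N :=
  if N is M.+1 then fun x => (~~ x.1, antipode x.2) else id.

Fixpoint cube0 (N : nat) : cube N :=
  if N is M.+1 then (false, cube0 M) else tt.

Section Hamming.
Variable N : nat.
Implicit Types x y z : cube N.

Lemma ham_eq0 x y : ham x y = 0%N <-> x = y.
Proof.
elim: N x y => [[] []//|M IH [a x] [b y]] /=; split.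
  by move=> /eqP; rewrite addn_eq0 => /andP[ab /eqP/IH ->]; case: a b ab => -[].
by move=> [-> /IH ->]; rewrite eqxx.
Qed.

Lemma ham_sym x y : ham x y = ham y x.
Proof. by elim: N x y => [//|M IH [a x] [b y]] /=; rewrite IH eq_sym. Qed.

Lemma ham_triangle x y z : (ham x z <= ham x y + ham y z)%N.
Proof.
elim: N x y z => [//|M IH [a x] [b y] [c z]] /=.
rewrite addnACA; apply: leq_add => //.
by case: a; case: b; case: c.
Qed.

Lemma ham_antipode x : ham x (antipode x) = N.
Proof. by elim: N x => [//|M IH [a x]] /=; rewrite IH; case: a. Qed.

Lemma antipodeK : involutive (@antipode N).
Proof. by elim: N => [//|M IH [a x]] /=; rewrite IH negbK. Qed.

Lemma card_cube_gt0 : (0 < #|cube N|)%N.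
Proof. by apply/card_gt0P; exists (cube0 N). Qed.

End Hamming.

Section CubeMean.
Context {R : realType}.

Definition mean N (f : cube N -> R) : R := (\sum_x f x) / #|cube N|%:R.

Let card_gt0 N : 0 < #|cube N|%:R :> R.
Proof. by rewrite ltr0n card_cube_gt0. Qed.

Let card_neq0 N : #|cube N|%:R != 0 :> R.
Proof. by rewrite gt_eqF. Qed.

Lemma mean_cst N (c : R) : mean (fun _ : cube N => c) = c.
Proof. by rewrite /mean sumr_const -(mulr_natr c) mulfK. Qed.

Lemma meanD N (f g : cube N -> R) : mean (fun x => f x + g x) = mean f + mean g.
Proof. by rewrite /mean big_split mulrDl. Qed.

Lemma meanZ N (c : R) (f : cube N -> R) : mean (fun x => c * f x) = c * mean f.
Proof. by rewrite /mean -mulr_sumr mulrA. Qed.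

Lemma meanB N (f g : cube N -> R) : mean (fun x => f x - g x) = mean f - mean g.
Proof. by rewrite /mean sumrB mulrBl. Qed.

Lemma le_mean N (f g : cube N -> R) : (forall x, f x <= g x) -> mean f <= mean g.
Proof. by move=> fg; rewrite ler_pM2r ?invr_gt0//; exact: ler_sum. Qed.

Lemma mean_dist N (f g : cube N -> R) (c : R) :
  (forall x, `|f x - g x| <= c) -> `|mean f - mean g| <= c.
Proof.
move=> fg; rewrite -meanB ler_norml; apply/andP; split.
  rewrite -(mean_cst N (- c)); apply: le_mean => x.
  by have := fg x; rewrite ler_norml => /andP[].
rewrite -[leRHS](mean_cst N c); apply: le_mean => x.
by have := fg x; rewrite ler_norml => /andP[].
Qed.

Lemma mean_antipode N (f : cube N -> R) : mean (fun x => f (antipode x)) = mean f.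
Proof.
by rewrite /mean [in RHS](reindex_inj (can_inj (@antipodeK N))).
Qed.

Lemma meanS N (f : cube N.+1 -> R) :
  mean f = (mean (fun x => f (true, x)) + mean (fun x => f (false, x))) / 2.
Proof.
have sumE : \sum_(x : cube N.+1) f x = \sum_x f (true, x) + \sum_x f (false, x).
  transitivity (\sum_(p : bool * cube N) f (p.1, p.2)).
    by apply: eq_bigr => -[].
  by rewrite -(pair_bigA _ (fun a (x : cube N) => f (a, x))) big_bool.
have cardE : #|cube N.+1| = (2 * #|cube N|)%N by rewrite card_prod card_bool.
by rewrite /mean sumE cardE natrM; field; rewrite card_neq0.
Qed.

(* Efron-Stein: each coordinate contributes at most c^2/4 to the variance. *)
Lemma cube_variance N (f : cube N -> R) (c : R) : 0 <= c ->
  (forall x y, `|f x - f y| <= c * (ham x y)%:R) ->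
  mean (fun x => f x ^+ 2) - mean f ^+ 2 <= c ^+ 2 / 4 * N%:R.
Proof.
move=> c0; elim: N f => [|N IH] f fc.
  rewrite mulr0; have fE : f = fun=> f tt by apply/funext => -[].
  by rewrite fE !mean_cst subrr.
have IHb b : mean (fun x => f (b, x) ^+ 2) - mean (fun x => f (b, x)) ^+ 2 <=
    c ^+ 2 / 4 * N%:R.
  by apply: IH => x y; have := fc (b, x) (b, y); rewrite /= eqxx.
have : `|mean (fun x => f (true, x)) - mean (fun x => f (false, x))| <= c.
  apply: mean_dist => x; have := fc (true, x) (false, x).
  by rewrite /= (ham_eq0 x x).2// addn0 mulr1.
rewrite !meanS -natr1; have := IHb true; have := IHb false.
set A := mean _; set a := mean _; set B := mean _; set b := mean _.
move=> h1 h2; rewrite ler_norml => /andP[h3 h4].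
have h5 : (b - a) ^+ 2 <= c ^+ 2 by nra.
(* Law of total variance over the first coordinate: mean of the two conditional variances plus the
   variance of the conditional means. *)
have -> : (B + A) / 2 - ((b + a) / 2) ^+ 2 =
  ((A - a ^+ 2) + (B - b ^+ 2)) / 2 + (b - a) ^+ 2 / 4 by field.
lra.
Qed.

Lemma cube_chebyshev N (f : cube N -> R) (c e : R) : 0 <= c -> 0 < e ->
  (forall x y, `|f x - f y| <= c * (ham x y)%:R) ->
  mean (fun x => (e < `|f x - mean f|)%R%:R) <= c ^+ 2 / 4 * N%:R / e ^+ 2.
Proof.
move=> c0 e0 fc; rewrite ler_pdivlMr ?exprn_gt0//.
apply: le_trans (cube_variance c0 fc).
have -> : mean (fun x => f x ^+ 2) - mean f ^+ 2 =
    mean (fun x => (f x - mean f) ^+ 2).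
  under [in RHS]eq_fun do rewrite sqrrB.
  rewrite meanD meanB mean_cst.
  have -> : mean (fun x => f x * mean f *+ 2) = mean f ^+ 2 *+ 2.
    under eq_fun do rewrite -mulrnAl mulrC -mulr_natl mulrA.
    by rewrite meanZ; ring.
  by ring.
rewrite mulrC -meanZ; apply: le_mean => x.
case: ltP => h; last by rewrite mulr0 sqr_ge0.
rewrite mulr1 -(real_normK (num_real (f x - mean f))) ler_sqr ?nnegrE//.
  exact: ltW.
exact: ltW.
Qed.

End CubeMean.

(** * Two glued cubes *)

Section TwoClumps.
Context {R : realType}.
Variables (s L : R) (N : nat).
Hypotheses (s_gt0 : 0 < s) (L_gt0 : 0 < L) (N_gt0 : (0 < N)%N).

Definition pair_dist (a b : bool) : R := s * (a != b)%:R.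

Lemma pair_dist_metric : is_metric pair_dist.
Proof.
have sp := s_gt0; rewrite /pair_dist; split; [|split].
- by move=> [] []; split => //=; rewrite ?mulr1 ?mulr0//; lra.
- by move=> a b; rewrite eq_sym.
- by move=> [] [] [] /=; lra.
Qed.

(** The factor [L / N] keeps the diameter of each copy at [L], while 1-Lipschitz functions have
    variance at most [L ^+ 2 / (4 * N)] there. *)
Definition clump_dist (p q : bool * cube N) : R :=
  pair_dist p.1 q.1 + L / N%:R * (ham p.2 q.2)%:R.

Let LN_gt0 : 0 < L / N%:R. Proof. by rewrite divr_gt0// ltr0n. Qed.

Let pd_ge0 a b : 0 <= pair_dist a b. Proof. exact: (metric_ge0 pair_dist_metric). Qed.

Lemma clump_dist_metric : is_metric clump_dist.
Proof.
have [p0 [pC pt]] := pair_dist_metric; rewrite /clump_dist; split; [|split].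
- move=> [a x] [b y] /=; split => [/eqP|[-> ->]]; last first.
    by rewrite (p0 b b).2// (ham_eq0 y y).2// mulr0 addr0.
  rewrite paddr_eq0 ?pd_ge0 ?(mulr_ge0 (ltW LN_gt0))// => /andP[/eqP/p0 ->].
  by rewrite mulf_eq0 gt_eqF//= pnatr_eq0 => /eqP/ham_eq0 ->.
- by move=> p q; rewrite pC ham_sym.
- move=> p q r; rewrite addrACA; apply: lerD; first exact: pt.
  by rewrite -mulrDr ler_pM2l// -natrD ler_nat; exact: ham_triangle.
Qed.

Lemma clump_dist_antipode x : clump_dist (true, x) (false, antipode x) = s + L.
Proof.
by rewrite /clump_dist /pair_dist /= ham_antipode mulr1 divfK// pnatr_eq0 -lt0n.
Qed.

Definition two_points : mmspace R := fin_mm false pair_dist.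
Definition clumps : mmspace R := fin_mm (false, cube0 N) clump_dist.

Let phi : R -> bool * cube N := unif_param (false, cube0 N).

Lemma clumps_param : is_parameter clumps phi.
Proof. exact: fin_mm_param. Qed.

(** Both spaces are read off the same [phi], so a function on two points and its lift to the cubes
    pull back to the same function. *)
Let fst_param t : bool := (phi t).1.

Let sum_prod (f : bool * cube N -> R) :
  \sum_p f p = \sum_x f (true, x) + \sum_x f (false, x).
Proof.
transitivity (\sum_(p : bool * cube N) f (p.1, p.2)).
  by apply: eq_bigr => -[].
by rewrite -(pair_bigA _ (fun a (x : cube N) => f (a, x))) big_bool.
Qed.

Let sum_prod_mean (f : bool * cube N -> R) :
  (\sum_p f p) / #|{: bool * cube N}|%:R =
  (mean (fun x => f (true, x)) + mean (fun x => f (false, x))) / 2.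
Proof.
rewrite sum_prod /mean card_prod card_bool natrM; field.
by rewrite pnatr_eq0 -lt0n card_cube_gt0.
Qed.

Lemma two_points_param : is_parameter two_points fst_param.
Proof.
split => [_ B _|A _].
  exact: (@unif_param_measurable _ _ _ [set p : bool * cube N | B p.1]).
rewrite fin_mm_meas lamE; congr EFin.
have -> : fst_param @^-1` A = phi @^-1` [set p | A p.1] by [].
rewrite lam_unif_param sum_prod_mean card_bool big_bool /=.
have m b : mean (fun x : cube N => ((b, x) \in [set p : bool * cube N | A p.1])%:R) =
    (b \in A)%:R :> R.
  by rewrite -[RHS](mean_cst N).
by rewrite !m.
Qed.

(** Chebyshev on each copy. The deviation set is the preimage of a set of points, so the bound holds
    for every parameter. *)
Lemma clumps_concentration (h : bool * cube N -> R) (C e : R) (phi' : R -> mm_T clumps) :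
  0 <= C -> 0 < e -> (forall p q, `|h p - h q| <= C * clump_dist p q) ->
  is_parameter clumps phi' ->
  lam [set t | e < `|h (phi' t) - mean (fun x => h ((phi' t).1, x))|] <=
    C ^+ 2 * (L ^+ 2 / (4 * N%:R)) / e ^+ 2.
Proof.
move=> C0 e0 hC [_ pphi].
pose A : set (bool * cube N) :=
  [set p | e < `|h p - mean (fun x => h (p.1, x))|].
have {1}-> : [set t | e < `|h (phi' t) - mean (fun x => h ((phi' t).1, x))|]
  = phi' @^-1` A by [].
rewrite -lee_fin -lamE pphi; last exact: (fin_measurable clump_dist_metric).
rewrite fin_mm_meas lee_fin sum_prod_mean.
have cheb b : mean (fun x => ((b, x) \in A)%:R) <=
    C ^+ 2 * (L ^+ 2 / (4 * N%:R)) / e ^+ 2.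
  have -> : C ^+ 2 * (L ^+ 2 / (4 * N%:R)) / e ^+ 2 =
      (C * (L / N%:R)) ^+ 2 / 4 * N%:R / e ^+ 2.
    by field; rewrite gt_eqF//= pnatr_eq0 -lt0n.
  apply: le_trans (@cube_chebyshev _ N (fun x => h (b, x)) _ _ _ e0 _).
  - apply: le_mean => x; rewrite ler_nat.
    by have [/set_mem|//] := boolP ((b, x) \in A); rewrite /A /= => ->.
  - by rewrite mulr_ge0// ltW.
  - move=> x y; apply: (le_trans (hC _ _)); rewrite /clump_dist /pair_dist /=.
    by rewrite eqxx mulr0 add0r mulrA.
have := cheb true; have := cheb false; lra.
Qed.

(** Functions on the cubes are sent to their means over each copy, functions on two points to their
    lifts. The cube of [e] comes from asking the Chebyshev bound to be at most [e]. *)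
Lemma clumps_dconc (e : R) : 0 < e -> L ^+ 2 / (4 * N%:R) <= e ^+ 3 ->
  dconc clumps two_points <= e.
Proof.
move=> e0 Le.
apply: (@param_close_dconc _ clumps two_points phi fst_param).
- exact: clump_dist_metric.
- exact: pair_dist_metric.
- exact: ltW.
- exact: clumps_param.
- exact: two_points_param.
split.
  move=> f Lf; exists (fun b => mean (fun x => f (b, x))).
    move=> a b; apply: mean_dist => x; apply: (le_trans (Lf _ _)).
    by rewrite /= /clump_dist /= (ham_eq0 x x).2// mulr0 addr0.
  apply: le_trans (@clumps_concentration f 1 e phi _ e0 _ clumps_param) _ => //.
    by move=> p q; rewrite mul1r; exact: Lf.
  rewrite expr1n mul1r ler_pdivrMr ?exprn_gt0// -exprS; exact: Le.
move=> g Lg; exists (g \o fst).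
  move=> p q; apply: (le_trans (Lg _ _)).
  by rewrite /= /clump_dist lerDl (mulr_ge0 (ltW LN_gt0)).
rewrite /close (_ : [set t | _] = set0) ?lam0 ?ltW//.
by apply/seteqP; split => // t /=; rewrite subrr normr0 ltNge ltW.
Qed.

(** The function with values [F s] and 0 on two points has a counterpart on the cubes that is almost
    constant on each copy, and the antipodal pairing bounds the gap between the two constants. *)
Lemma clumps_dconc_lb (F G : R -> R) (eta d0 c : R) :
  metric_preserving F -> metric_preserving G ->
  0 < eta -> 0 < d0 -> G d0 <= eta ->
  (eta * 2 / d0) ^+ 2 * (L ^+ 2 / (4 * N%:R)) / eta ^+ 2 < 1 / 4 -> c <= 1 / 4 ->
  dconc (mm_comp G clumps) (mm_comp F two_points) < c ->
  F s <= G (s + L) + c * 2 + eta * 8.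
Proof.
move=> mpF mpG eta0 d00 Gd0 small c4 /dconc_param_close[].
- exact: (@mp_is_metric _ G clumps mpG clump_dist_metric).
- exact: (@mp_is_metric _ F two_points mpF pair_dist_metric).
- exists phi, fst_param; split; [exact: clumps_param|exact: two_points_param].
move=> phi' [psi' [pphi ppsi [_ pc]]].
pose g (b : bool) : R := if b then F s else 0.
have Fs0 := mp_ge0 mpF (ltW s_gt0).
have [|f Lf fc] := pc g.
  move=> a b /=; rewrite /pair_dist /g.
  by case: a; case: b => /=; rewrite ?mulr0 ?mulr1 ?subrr ?normr0
    ?(mp0 mpF)// ?subr0 ?sub0r ?normrN ger0_norm.
have LfG p q : `|f p - f q| <= G (clump_dist p q) by exact: Lf.
pose C := eta * 2 / d0.
have C0 : 0 < C by rewrite divr_gt0// mulr_gt0.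
have [|ft [ftL ftf]] :=
    @lip_regularization _ _ clump_dist f (eta * 2) C clump_dist_metric C0.
  move=> p q; apply: (le_trans (LfG p q)); apply: mp_linear => //.
  exact: (metric_ge0 clump_dist_metric).
pose m b := mean (fun x => ft (b, x)).
have mm : `|m true - m false| <= eta * 2 + G (s + L).
  (* Pairing [(true, x)] with [(false, antipode x)] places all pairs at distance exactly [s + L]. *)
  rewrite /m -(mean_antipode (fun x => ft (false, x))).
  apply: mean_dist => x; rewrite -(clump_dist_antipode x).
  have := LfG (true, x) (false, antipode x).
  have := ftf (true, x); have := ftf (false, antipode x).
  by rewrite !ler_norml; lra.
have bad := @clumps_concentration ft C eta phi' (ltW C0) eta0 ftL pphi.
(* The copy [b'] need not be [b]. Half of [0, 1) is sent to [b], more than the exceptional mass,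
   which is below [c + 1 / 4]. *)
have key b : exists b', `|m b' - g b| <= c + eta * 3.
  have lamb : lam (psi' @^-1` [set b]) = 1 / 2.
    have [_ /(_ [set b])] := ppsi; rewrite lamE fin_mm_meas => h.
    have [->] := h (fin_measurable pair_dist_metric _).
    have eb a : (a \in [set b]) = (a == b).
      by apply/idP/eqP => [/set_mem//|->]; exact: mem_set.
    by rewrite big_bool /= !eb card_bool; case: b {h eb}; rewrite /= ?addr0 ?add0r.
  pose B1 := [set t | c < `|f (phi' t) - g (psi' t)|].
  pose B2 := [set t | eta < `|ft (phi' t) - m (phi' t).1|].
  have : lam (B1 `|` B2) < lam (psi' @^-1` [set b]).
    apply: (le_lt_trans (lamU _ _)); rewrite lamb.
    have l1 : lam B1 <= c := fc.
    have l2 : lam B2 < 1 / 4 := le_lt_trans bad small.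
    by lra.
  move=> /lam_exists[t [_ /= <- /not_orP[]]].
  rewrite /B1 /B2 /= => /negP; rewrite -leNgt => h1 /negP; rewrite -leNgt => h2.
  exists (phi' t).1; have := ftf (phi' t); move: h1 h2; rewrite !ler_norml; lra.
have [b1 h1] := key true; have [b0 h0] := key false.
have m10 : `|m b1 - m b0| <= eta * 2 + G (s + L).
  have G0 : 0 <= G (s + L) by apply: (mp_ge0 mpG); rewrite addr_ge0// ltW.
  have z b : `|m b - m b| <= eta * 2 + G (s + L) by rewrite subrr normr0; lra.
  by case: b1 b0 {h1 h0} => -[] //; rewrite distrC.
move: h1 h0 m10; rewrite /g !ler_norml; lra.
Qed.

End TwoClumps.

(** * Stability of concentration implies asymptotic monotonicity *)

Lemma concentrates_asymptotic_mono (R : realType) (Fs : nat -> R -> R) (F : R -> R) :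
  (forall n, metric_preserving (Fs n)) -> cont_metric_preserving F ->
  (forall s, 0 <= s -> Fs n s @[n --> \oo] --> F s) ->
  (forall (Xs : nat -> mmspace R) (X : mmspace R),
    (forall n, is_mm (Xs n)) -> is_mm X -> concentrates Xs X ->
    concentrates (fun n => mm_comp (Fs n) (Xs n)) (mm_comp F X)) ->
  forall s, 0 <= s ->
    (Fs n s - inf [set Fs n t | t in [set t | s <= t]]) @[n --> \oo] --> 0.
Proof.
move=> mpFs cF FsF conc s s0.
have v_ge0 n : 0 <= Fs n s - inf [set Fs n t | t in [set t | s <= t]].
  by rewrite subr_ge0; exact: mp_inf_le.
apply/cvgrPdist_le => e e0.
suff : \forall n \near \oo, forall t, s <= t -> Fs n s - e <= Fs n t.
  apply: filterS => n h; rewrite sub0r normrN ger0_norm// lerBlDr -lerBlDl.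
  apply: lb_le_inf; first by exists (Fs n s); exists s => /=.
  by move=> _ [t /= st <-]; exact: h.
have [s_eq0|s_neq0] := eqVneq s 0.
  apply: nearW => n t; rewrite s_eq0 (mp0 (mpFs n)) => t0.
  by have := mp_ge0 (mpFs n) t0; lra.
have s_gt0 : 0 < s by rewrite lt0r s_neq0.
(* When [Fs n] has no drop below [Fs n s - e], the length 1 is a placeholder that keeps the sequence
   of spaces defined for all [n]. *)
have tn n : {L : R | 0 < L &
    (forall t, s <= t -> Fs n s - e <= Fs n t) \/ Fs n (s + L) < Fs n s - e}.
  apply: cid2; have [h|] := pselect (forall t, s <= t -> Fs n s - e <= Fs n t).
    by exists 1 => //; left.
  move=> /existsNP[t /not_implyP[st /negP]]; rewrite -ltNge => ht.
  exists (t - s); last by right; rewrite addrC subrK.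
  rewrite subr_gt0 lt_neqAle st andbT; apply/eqP => E; move: ht; rewrite E; lra.
pose L n := s2val (tn n).
have L_gt0 n : 0 < L n by rewrite /L; case: (tn n).
have LP n : (forall t, s <= t -> Fs n s - e <= Fs n t) \/
    Fs n (s + L n) < Fs n s - e by rewrite /L; case: (tn n).
pose r n : R := n.+1%:R^-1.
have r_gt0 n : 0 < r n by rewrite invr_gt0.
(* The dimension is large enough for [clumps_dconc] to bound the observable distance by [r n]. *)
pose N n := (Num.truncn (L n ^+ 2 / r n ^+ 3)).+1.
have NP n : L n ^+ 2 / (4 * (N n)%:R) <= r n ^+ 3.
  rewrite ler_pdivrMr ?mulr_gt0// -ler_pdivrMl ?exprn_gt0// mulrC.
  have h : L n ^+ 2 / r n ^+ 3 < (N n)%:R by exact: truncnS_gt.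
  by have := ler0n R (N n); lra.
pose Xs n := clumps s (L n) (N n).
have mmXs n : is_mm (Xs n).
  by apply: fin_mm_is_mm; exact: clump_dist_metric.
have mmX : is_mm (two_points s) by apply: fin_mm_is_mm; exact: pair_dist_metric.
have r_cvg : r n @[n --> \oo] --> 0 by exact: cvg_harmonic.
have XsX : concentrates Xs (two_points s).
  apply/concentratesP => a a0.
  have ra : \forall n \near \oo, r n < a by exact: cvgr_lt r_cvg _ a0.
  apply: filterS ra => n; apply: le_lt_trans; exact: clumps_dconc.
have /concentratesP FXs := conc _ _ mmXs mmX XsX.
(* The losses add up to [c * 2 + eta * 9], at most [eta * 11], which is less than the drop [e]. *)
pose eta := e / 20.
have eta0 : 0 < eta by rewrite divr_gt0.
have [d0 d00 Fd0] := cont_mp_small cF eta0.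
pose c := Num.min (1 / 4) eta.
have c0 : 0 < c by rewrite lt_min divr_gt0.
have c4 : c <= 1 / 4 by rewrite ge_min lexx.
have ce : c <= eta by rewrite ge_min lexx orbT.
pose C := (eta * 2 / d0) ^+ 2 / eta ^+ 2.
have C0 : 0 < C by rewrite divr_gt0// exprn_gt0// divr_gt0// mulr_gt0.
have r3 : \forall n \near \oo, C * r n ^+ 3 < 1 / 4.
  have rC : \forall n \near \oo, r n < 1 / 4 / C.
    have C4 : 0 < 1 / 4 / C by rewrite divr_gt0// divr_gt0.
    exact: cvgr_lt r_cvg _ C4.
  apply: filterS rC => n; rewrite ltr_pdivlMr// mulrC; apply: le_lt_trans.
  rewrite ler_pM2l// exprS ler_piMr ?(ltW (r_gt0 _))//.
  by rewrite exprn_ile1 ?(ltW (r_gt0 _))// invf_le1 ?ler1n.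
have Gd0 : \forall n \near \oo, Fs n d0 <= eta.
  exact: cvgr_le (FsF _ (ltW d00)) _ Fd0.
have Fss : \forall n \near \oo, Fs n s <= F s + eta.
  have Fse : F s < F s + eta by rewrite ltrDl.
  exact: cvgr_le (FsF _ s0) _ Fse.
have dc := FXs _ c0.
near=> n.
have [//|h] := LP n.
have : F s <= Fs n (s + L n) + c * 2 + eta * 8.
  apply: (@clumps_dconc_lb _ s (L n) (N n) _ _ _ F (Fs n) eta d0 c) => //.
  - exact: cF.1.
  - by near: n.
  - rewrite mulrAC -/C; apply: (@le_lt_trans _ _ (C * r n ^+ 3)).
      by rewrite ler_pM2l.
    by near: n.
  - by near: n.
have : Fs n s <= F s + eta by near: n.
have : eta * 20 = e by rewrite /eta divfK.
lra.
Unshelve. all: by end_near. Qed.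

Theorem theorem1p4 (R : realType) (Fs : nat -> R -> R) (F : R -> R) :
  (forall n, cont_metric_preserving (Fs n)) ->
  cont_metric_preserving F ->
  (forall s, 0 <= s -> Fs n s @[n --> \oo] --> F s) ->
  ((forall (Xs : nat -> mmspace R) (X : mmspace R),
      (forall n, is_mm (Xs n)) -> is_mm X -> concentrates Xs X ->
      concentrates (fun n => mm_comp (Fs n) (Xs n)) (mm_comp F X))
   <->
   (forall s, 0 <= s ->
      (Fs n s - inf [set Fs n t | t in [set t | s <= t]]) @[n --> \oo] --> 0)).
Proof.
move=> cFs cF FsF; have mpFs n : metric_preserving (Fs n) by case: (cFs n).
by split; [exact: concentrates_asymptotic_mono|exact: asymptotic_mono_concentrates].
Qed.
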